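(* Let a protocol with $n$ backups, fault threshold $f$ and communication structure $G=[(T_1)_{r_1}^{M_1},\dots,(T_{|G|})_{r_{|G|}}^{M_{|G|}}]$ be given, and let node activation be governed by the probabilistic model described in the context. Then the consensus reliability $P_C$, i.e. the probability that the number of activated nodes in phase $0$ is at least $n-f$ and the number of activated nodes in phase $j$ is at least $M_j$ for every $j=1,\dots,|G|$, equals $$P_C=\sum_{\substack{n\ge x_0\ge n-f\\ S_{x_0}^{G_0}\subseteq\Omega}}\cdots\sum_{\substack{x_{j-r_j}\ge x_j\ge M_j\\ S_{x_j}^{G_j}\subseteq S_{x_{j-r_j}}^{G_{j-r_j}}}}\cdots\sum_{\substack{x_{|G|-r_{|G|}}\ge x_{|G|}\ge M_{|G|}\\ S_{x_{|G|}}^{G_{|G|}}\subseteq S_{x_{|G|-r_{|G|}}}^{G_{|G|-r_{|G|}}}}} P\left(S_{x_0}^{G_0},S_{x_1}^{G_1},\dots,S_{x_{|G|}}^{G_{|G|}}\right),$$ where there is one summation for each phase $j=0,1,\dots,|G|$, the summation for phase $j$ running over integers $x_j$ in the indicated range and all sets $S_{x_j}^{G_j}$ of cardinality $x_j$ contained in the indicated set, and where $$P\left(S_{x_0}^{G_0},S_{x_1}^{G_1},\dots,S_{x_{|G|}}^{G_{|G|}}\right)=P\left(S_{x_0}^{G_0}\right)\prod_{j=1}^{|G|}P\left(S_{x_j}^{G_j}\,\middle|\,S_{x_{j-r_j}}^{G_{j-r_j}}\right),$$ $$P\left(S_{x_0}^{G_0}\right)=\prod_{u\in S_{x_0}^{G_0}}P_u^{G_0}\prod_{v\in\Omega\setminus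 S_{x_0}^{G_0}}\left(1-P_v^{G_0}\right),$$ $$P\left(S_{x_j}^{G_j}\,\middle|\,S_{x_{j-r_j}}^{G_{j-r_j}}\right)=\prod_{u\in S_{x_j}^{G_j}}P_u^{G_j}\prod_{v\in S_{x_{j-r_j}}^{G_{j-r_j}}\setminus S_{x_j}^{G_j}}\left(1-P_v^{G_j}\right)\qquad(j=1,\dots,|G|).$$ Here $P_i^{G_j}$ is the activation probability of node $i$ in phase $j$ (which, when $T_j=C$, depends on the set $S_{x_{j-r_j}}^{G_{j-r_j}}$), as defined in the context.
   Context: Nodes. There is a primary node and a set $\Omega=\{1,\dots,n\}$ of $n$ backup nodes; $f$ is an integer with $0\le f<n$ (the maximum number of faulty nodes the protocol tolerates). The primary is assumed to work correctly (only normal-case operation is analyzed). Communication structure. A protocol is described by a finite list $G=[G_1,\dots,G_{|G|}]$ of communication components $G_j=(T_j)_{r_j}^{M_j}$, one for each phase $j=1,\dots,|G|$. Here $T_j\in\{A,B,C\}$ is the communication graph ($A$: one-to-many, primary to backups; $B$: many-to-one, backups to primary; $C$: many-to-many among backups), $r_j$ is an integer with $1\le r_j\le j$ (phase $j$ depends on phase $j-r_j$), and $M_j\ge 1$ is the minimum number of activated nodes required at the end of phase $j$. Phase $0$ denotes the start of the protocol. Activated nodes. The set of activated nodes in phase $0$ is the set of non-faulty backups. For $j\ge1$, a backup $i$ is activated in phase $j$ if and only if it was activated in phase $j-r_j$ and: - if $T_j=A$, the message from the primary to $i$ in phase $j$ is successfully delivered; - if $T_j=B$, the message from $i$ to the primary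 in phase $j$ is successfully delivered; - if $T_j=C$, $i$ successfully receives at least $n-f-1$ of the messages sent to it in phase $j$ by the other nodes activated in phase $j-r_j$. Probabilities. Node $i$ is non-faulty with probability $P_i^{G_0}$. A transmission from $u$ to $v$ succeeds with probability $P_L^{u,v}$. All node-fault events and all transmission successes (over all links and all phases) are mutually independent. Consequently, given the sets of activated nodes in phases $0,\dots,j-1$, the set of activated nodes in phase $j$ is a subset of the set in phase $j-r_j$ and its conditional law depends only on that set. Notation. $S_{x_j}^{G_j}\subseteq\Omega$ denotes a possible value of the set of activated nodes at the end of phase $j$, with $|S_{x_j}^{G_j}|=x_j$. $P(S_{x_0}^{G_0},\dots,S_{x_{|G|}}^{G_{|G|}})$ is the probability that for every $j$ the set of activated nodes in phase $j$ is $S_{x_j}^{G_j}$; $P(S_{x_j}^{G_j}\mid S_{x_i}^{G_i})$ is the corresponding conditional probability. Activation probabilities. For $j\ge1$ and $i\in S:=S_{x_{j-r_j}}^{G_{j-r_j}}$, $P_i^{G_j}$ is the probability that $i$ is activated in phase $j$ given that the set of activated nodes in phase $j-r_j$ is $S$: $P_i^{G_j}=P_L^{\mathrm{primary},i}$ if $T_j=A$; $P_i^{G_j}=P_L^{i,\mathrm{primary}}$ if $T_j=B$; and if $T_j=C$, $$P_i^{G_j}=\sum_{k=n-f-1}^{x_{j-r_j}-1}\ \sum_{\substack{S_k\subseteq S\setminus\{i\}\\|S_k|=k}}\ \prod_{u\in S_k}P_L^{u,i}\prod_{v\in S\setminus(\{i\}\cup S_k)}\left(1-P_L^{v,i}\right).$$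 *)

(* Defs.v *)
From HB Require Import structures.
From mathcomp Require Import all_boot all_order all_algebra.
From mathcomp Require Import all_classical all_reals all_analysis.

Set Implicit Arguments.
Unset Strict Implicit.
Unset Printing Implicit Defensive.

Import Order.TTheory GRing.Theory Num.Theory.

Local Open Scope classical_set_scope.
Local Open Scope ring_scope.

Definition prob (R : realType) (d : measure_display) (T : measurableType d)
    (P : probability T R) (A : set T) : R := fine (P A).

(* Equal to 0, hence meaningless, when the conditioning event is null. *)
Definition cond_prob (R : realType) (d : measure_display)
    (T : measurableType d) (P : probability T R) (A B : set T) : R :=
  prob P (A `&` B) / prob P B.

Definition mutually_independent (R : realType) (d : measure_display)
    (T : measurableType d) (P : probability T R) (I : eqType) (D : {pred I})
    (E : I -> set T) : Prop :=
  forall s : seq I, uniq s -> {subset s <= D} ->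
    prob P (\bigcap_(i in [set` s]) E i) = \prod_(i <- s) prob P (E i).

(* OneToMany, ManyToOne and ManyToMany are the graphs A, B and C. *)
Inductive comm_graph : Type := OneToMany | ManyToOne | ManyToMany.

(* (T)_r^M *)
Record component : Type := Component {
  graph : comm_graph;
  dep : nat;
  min_active : nat
}.

(* The component of phase j >= 1 is item j - 1 of the list. *)
Definition phase (G : seq component) (j : nat) : component :=
  nth (Component OneToMany 0 0) G j.-1.

Definition well_formed (G : seq component) : Prop :=
  forall j : nat, (1 <= j <= size G)%N ->
    (1 <= dep (phase G j) <= j)%N /\ (1 <= min_active (phase G j))%N.

(* The backups are 'I_n; Some i is backup i and None is the primary. *)
Definition node (n : nat) : Type := option 'I_n.
Definition primary {n : nat} : node n := None.
Definition backup {n : nat} (i : 'I_n) : node n := Some i.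

Definition link (n : nat) (g : comm_graph) (u v : node n) : bool :=
  match g, u, v with
  | OneToMany, None, Some _ => true
  | ManyToOne, Some _, None => true
  | ManyToMany, Some i, Some k => i != k
  | _, _, _ => false
  end.

(* inl i stands for "i is non-faulty" and inr (j, (u, v)) for "the transmission
   from u to v in phase j succeeds". *)
Definition source (n : nat) : Type := ('I_n + nat * (option 'I_n * option 'I_n))%type.

Definition sources (n : nat) (G : seq component) : {pred source n} :=
  fun s => match s with
  | inl _ => true
  | inr (j, (u, v)) => (1 <= j <= size G)%N && link (graph (phase G j)) u v
  end.
Arguments sources : clear implicits.

Definition source_event (T : Type) (n : nat) (nonfaulty : 'I_n -> set T)
    (delivered : nat -> node n -> node n -> set T) (s : source n) : set T :=
  match s with
  | inl i => nonfaulty i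
  | inr (j, (u, v)) => delivered j u v
  end.

(* Given that S is the set of activated nodes in the phase that phase j depends
   on and that i is in S: does i get activated in phase j in the outcome w? *)
Definition activates (T : Type) (n f : nat)
    (delivered : nat -> node n -> node n -> set T) (w : T)
    (g : comm_graph) (j : nat) (S : {set 'I_n}) (i : 'I_n) : bool :=
  match g with
  | OneToMany => w \in delivered j primary (backup i)
  | ManyToOne => w \in delivered j (backup i) primary
  | ManyToMany =>
      (n - f - 1 <=
       #|[set u in S :\ i | w \in delivered j (backup u) (backup i)]%SET|)%N
  end.

(* The list of the sets of activated nodes in phases 0, ..., |G|.  When the list
   h of those of phases 0, ..., j - 1 is known, j is the size of h. *)
Definition activation_history (T : Type) (n f : nat)
    (nonfaulty : 'I_n -> set T) (delivered : nat -> node n -> node n -> set T)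
    (G : seq component) (w : T) : seq {set 'I_n} :=
  foldl (fun h c =>
           let S := nth finset.set0 h (size h - dep c) in
           rcons h [set i in S |
                     activates f delivered w (graph c) (size h) S i]%SET)
        [:: [set i | w \in nonfaulty i]%SET] G.

Definition activated (T : Type) (n f : nat)
    (nonfaulty : 'I_n -> set T) (delivered : nat -> node n -> node n -> set T)
    (G : seq component) (j : nat) (w : T) : {set 'I_n} :=
  nth finset.set0 (activation_history f nonfaulty delivered G w) j.

(* Checks that the encoding by lists satisfies the recursion over phases. *)
Lemma size_activation_history (T : Type) (n f : nat)
    (nonfaulty : 'I_n -> set T) (delivered : nat -> node n -> node n -> set T)
    (G : seq component) (w : T) :
  size (activation_history f nonfaulty delivered G w) = (size G).+1.
Proof.
elim/last_ind: G => [//|G c IH].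
by rewrite /activation_history foldl_rcons !size_rcons -IH.
Qed.

Lemma activated_rcons (T : Type) (n f : nat)
    (nonfaulty : 'I_n -> set T) (delivered : nat -> node n -> node n -> set T)
    (G : seq component) (c : component) (j : nat) (w : T) : (j <= size G)%N ->
  activated f nonfaulty delivered (rcons G c) j w =
  activated f nonfaulty delivered G j w.
Proof.
move=> jG; rewrite /activated /activation_history foldl_rcons nth_rcons.
by rewrite size_activation_history ltnS jG.
Qed.

Lemma activated0 (T : Type) (n f : nat)
    (nonfaulty : 'I_n -> set T) (delivered : nat -> node n -> node n -> set T)
    (G : seq component) (w : T) :
  activated f nonfaulty delivered G 0 w = [set i | w \in nonfaulty i]%SET.
Proof. by elim/last_ind: G => [//|G c IH]; rewrite activated_rcons. Qed.

Lemma activatedS (T : Type) (n f : nat)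
    (nonfaulty : 'I_n -> set T) (delivered : nat -> node n -> node n -> set T)
    (G : seq component) (j : nat) (w : T) :
  well_formed G -> (1 <= j <= size G)%N ->
  let c := phase G j in
  let S := activated f nonfaulty delivered G (j - dep c) w in
  activated f nonfaulty delivered G j w =
  [set i in S | activates f delivered w (graph c) j S i]%SET.
Proof.
elim/last_ind: G => [|G c IH] wf; first by case: j => [|j]; rewrite ?andbF.
have ph k : (1 <= k <= size G)%N -> phase (rcons G c) k = phase G k.
  by case: k => // k /=; rewrite /phase nth_rcons => ->.
have wfG : well_formed G.
  move=> k kG; rewrite -ph//; apply: wf.
  by case/andP: kG => -> /leqW; rewrite size_rcons.
move=> jG; have /andP[j1] := jG; rewrite size_rcons leq_eqVlt => /orP[/eqP jE|].
  have [/andP[r1 _] _] := wf _ jG; move: r1; rewrite jE /phase /=.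
  rewrite nth_rcons ltnn eqxx => r1; rewrite [in RHS]activated_rcons; last first.
    by rewrite leq_subLR -addn1 addnC leq_add2r.
  rewrite /activated /activation_history foldl_rcons nth_rcons.
  by rewrite !size_activation_history ltnn eqxx.
rewrite ltnS => jG'; have jj : (1 <= j <= size G)%N by rewrite j1.
rewrite /= ph// !activated_rcons//; last by rewrite (leq_trans (leq_subr _ _)).
exact: IH.
Qed.

(* P_i^{G_j} for a phase with graph g, S being the set of activated nodes in the
   phase it depends on and i being in S. *)
Definition activation_prob (R : realType) (n f : nat)
    (PL : node n -> node n -> R) (g : comm_graph) (S : {set 'I_n}) (i : 'I_n) : R :=
  match g with
  | OneToMany => PL primary (backup i)
  | ManyToOne => PL (backup i) primary
  | ManyToMany =>
      \sum_(n - f - 1 <= k < #|S|)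
        \sum_(Sk : {set 'I_n} | (Sk \subset S :\ i) && (#|Sk| == k))
          (\prod_(u in Sk) PL (backup u) (backup i)) *
          (\prod_(v in S :\: (i |: Sk)) (1 - PL (backup v) (backup i)))
  end.

Definition initial_prob (R : realType) (n : nat) (P0 : 'I_n -> R)
    (S0 : {set 'I_n}) : R :=
  (\prod_(u in S0) P0 u) * (\prod_(v in ~: S0) (1 - P0 v)).

Definition transition_prob (R : realType) (n f : nat)
    (PL : node n -> node n -> R) (g : comm_graph) (S S' : {set 'I_n}) : R :=
  (\prod_(u in S') activation_prob f PL g S u) *
  (\prod_(v in S :\: S') (1 - activation_prob f PL g S v)).

(* Iterated sum of F over the sequences of sets that extend the sequence h of the
   sets chosen for the first phases, the remaining components being G. *)
Fixpoint phase_sums (R : realType) (n : nat) (G : seq component)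
    (h : seq {set 'I_n}) (F : seq {set 'I_n} -> R) : R :=
  if G is c :: G' then
    let S := nth finset.set0 h (size h - dep c) in
    \sum_(min_active c <= x < #|S|.+1)
      \sum_(S' : {set 'I_n} | (S' \subset S) && (#|S'| == x))
        phase_sums G' (rcons h S') F
  else F h.

Definition reliability_sum (R : realType) (n f : nat) (G : seq component)
    (F : seq {set 'I_n} -> R) : R :=
  \sum_(n - f <= x0 < n.+1)
    \sum_(S0 : {set 'I_n} | #|S0| == x0) phase_sums G [:: S0] F.

(* Main.v *)
(* Every event of the protocol is a Boolean combination of finitely many independent
   source events, and events built from disjoint groups of sources are independent.
   Given the set S of nodes active in phase j - r_j, the activations in phase j of
   the nodes i in S depend on disjoint groups of sources, indexed by j and i, all of
   them disjoint from the sources of the earlier phases.  Hence, for a chain of sets,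
   the event that it is the activation history is an intersection over j of
   independent one-step events, whose probabilities are the transition
   probabilities.  Summing over the chains gives the reliability. *)

Require Import Defs.
From HB Require Import structures.
From mathcomp Require Import all_boot all_order all_algebra.
From mathcomp Require Import all_classical all_reals all_analysis.

Set Implicit Arguments.
Unset Strict Implicit.
Unset Printing Implicit Defensive.

Import Order.TTheory GRing.Theory Num.Theory.

Local Open Scope classical_set_scope.
Local Open Scope ring_scope.

(** * Elementary set identities and finite additivity *)

Lemma bigcap_cons (T : Type) (I : eqType) (i : I) (s : seq I) (E : I -> set T) :
  \bigcap_(j in [set` i :: s]) E j = E i `&` \bigcap_(j in [set` s]) E j.
Proof.
apply/seteqP; split=> w.
  by move=> h; split=> [|j /= js]; apply: h; rewrite /= inE ?eqxx ?js ?orbT.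
by move=> [Ei h] j; rewrite /= inE => /orP[/eqP->|/h].
Qed.

Section Prob.
Variables (R : realType) (d : measure_display) (T : measurableType d).
Variable P : probability T R.
Implicit Types A B : set T.

Lemma prob_ge0 A : 0 <= prob P A.
Proof. exact/fine_ge0/measure_ge0. Qed.

Lemma prob_setT : prob P setT = 1.
Proof. by rewrite /prob probability_setT. Qed.

Lemma probU A B : measurable A -> measurable B -> A `&` B = set0 ->
  prob P (A `|` B) = prob P A + prob P B.
Proof.
by move=> mA mB AB; rewrite /prob measureU// fineD// fin_num_measure.
Qed.

Lemma probD A B : measurable A -> measurable B ->
  prob P (A `\` B) = prob P A - prob P (A `&` B).
Proof.
move=> mA mB; apply/eqP; rewrite eq_sym subr_eq; apply/eqP.
rewrite -probU; first by rewrite setUC setUIDK.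
- exact: measurableD.
- exact: measurableI.
- by rewrite setDE setIACA setICl setI0.
Qed.

Lemma probC A : measurable A -> prob P (~` A) = 1 - prob P A.
Proof. by move=> mA; rewrite -setTD probD// setTI prob_setT. Qed.

Lemma prob_eq0 A B : measurable A -> measurable B -> A `<=` B ->
  prob P B = 0 -> prob P A = 0.
Proof.
move=> mA mB AB B0; apply/eqP; rewrite eq_le prob_ge0 andbT -B0.
by rewrite /prob fine_le ?fin_num_measure// le_measure// inE.
Qed.

(** Since [J] is finite, the event on the left is a finite disjoint union of slices [X = y]; this is
    why measurability is asked of the slices. *)
Lemma prob_partition (J : finType) (Q : pred J) (X : T -> J) A :
  (forall y, measurable (A `&` [set w | X w = y])) ->
  prob P (A `&` [set w | Q (X w)]) =
  \sum_(y | Q y) prob P (A `&` [set w | X w = y]).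
Proof.
move=> mX.
(* The induction runs over duplicate-free lists of values and carries measurability along, as
   additivity requires it of the tail. *)
suff {Q} : forall s : seq J, uniq s ->
    measurable (A `&` [set w | X w \in s]) /\
    prob P (A `&` [set w | X w \in s]) =
      \sum_(y <- s) prob P (A `&` [set w | X w = y]).
  move=> /(_ [seq y <- index_enum J | Q y]).
  rewrite big_filter => -[|_ <-]; first by rewrite filter_uniq ?index_enum_uniq.
  by congr (prob P (A `&` _)); apply/seteqP; split=> w /=;
    rewrite mem_filter mem_index_enum andbT.
elim=> [_|y s IH /= /andP[ys us]].
  have -> : A `&` [set w | X w \in [::]] = set0.
    by apply/seteqP; split=> w // -[].
  by split=> //; rewrite big_nil /prob measure0.
have [ms es] := IH us.
have -> : A `&` [set w | X w \in y :: s] =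
    A `&` [set w | X w = y] `|` A `&` [set w | X w \in s].
  rewrite -setIUr; congr (_ `&` _); apply/seteqP; split=> w /=; rewrite inE.
    by case/orP => [/eqP|]; [left|right].
  by case=> [->|->]; rewrite ?eqxx ?orbT.
split; first exact: measurableU.
rewrite big_cons -es probU//.
apply/seteqP; split=> w //= -[[_ yw] [_]]; rewrite yw => yins.
by rewrite yins in ys.
Qed.

End Prob.

(** * Events determined by disjoint groups of independent sources *)

Section Independence.
Variables (R : realType) (d : measure_display) (T : measurableType d).
Variables (P : probability T R) (I : eqType) (U : seq I) (E : I -> set T).
Hypothesis mE : forall s, s \in U -> measurable (E s).
Hypothesis indepE : mutually_independent P (mem U) E.

(* Only one implication is needed, the condition being symmetric in w and w'. *)
Definition depends (A : pred I) (F : set T) : Prop :=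
  forall w w', {in U, forall s, A s -> (w \in E s) = (w' \in E s)} ->
    F w -> F w'.

Lemma depends_sub (A B : pred I) F :
  {in U, subpred A B} -> depends A F -> depends B F.
Proof. by move=> AB dF w w' h; apply: dF => s sU /(AB _ sU); exact: h. Qed.

(** A pair [(i, b)] prescribes whether [E i] occurs. When the first components exhaust [U], the
    nonempty sets of this form are the atoms of the algebra generated by the sources. *)
Definition literals (l : seq (I * bool)) : set T :=
  [set w | forall y, y \in l -> (w \in E y.1) = y.2].

Lemma literals_nil : literals [::] = setT.
Proof. by apply/seteqP; split. Qed.

Lemma literals_cons i b l :
  literals ((i, b) :: l) = (if b then E i else ~` E i) `&` literals l.
Proof.
apply/seteqP; split=> w.
  move=> h; split; last by move=> y yl; apply: h; rewrite inE yl orbT.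
  have /= := h (i, b); rewrite inE eqxx => /(_ isT).
  by case: b {h} => /=; [move/set_mem|move/negbT; rewrite notin_setE].
case=> ib h y; rewrite inE => /orP[/eqP->|/h//] /=.
by case: b ib => /= [/mem_set//|]; rewrite -notin_setE => /negbTE.
Qed.

Lemma measurable_literals l :
  {subset map fst l <= U} -> measurable (literals l).
Proof.
elim: l => [|[i b] l IH] sub; first by rewrite literals_nil.
have iU : i \in U by apply: sub; rewrite inE eqxx.
rewrite literals_cons; apply: measurableI; last first.
  by apply: IH => j jl; apply: sub; rewrite inE jl orbT.
by case: b {sub}; [exact: mE|apply: measurableC; exact: mE].
Qed.

Lemma measurable_bigcap_seq (s : seq I) :
  {subset s <= U} -> measurable (\bigcap_(i in [set` s]) E i).
Proof.
elim: s => [|i s IH] sub; first by rewrite classical_sets.set_nil bigcap_set0.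
rewrite bigcap_cons; apply: measurableI.
  by apply: mE; apply: sub; rewrite inE eqxx.
by apply: IH => j js; apply: sub; rewrite inE js orbT.
Qed.

(** Mutual independence speaks of uncomplemented events only. In an induction on [l] for all [s], a
    positive literal joins [s], and a negative one is a difference: P(X \ E_i) = P(X) - P(X ∩
    E_i). *)
Lemma prob_bigcap_literals s l : uniq (s ++ map fst l) ->
  {subset s ++ map fst l <= U} ->
  prob P ((\bigcap_(i in [set` s]) E i) `&` literals l) =
  (\prod_(i <- s) prob P (E i)) *
  \prod_(y <- l) (if y.2 then prob P (E y.1) else 1 - prob P (E y.1)).
Proof.
elim: l s => [|[i b] l IH] s us sub.
  rewrite literals_nil setIT big_nil mulr1; apply: indepE.
    by move: us; rewrite cats0.
  by move: sub; rewrite cats0.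
have iU : i \in U by apply: sub; rewrite mem_cat !inE eqxx orbT.
have perm_is : perm_eq (s ++ map fst ((i, b) :: l)) ((i :: s) ++ map fst l).
  exact/permPl/(perm_catCA s [:: i]).
have us' : uniq ((i :: s) ++ map fst l) by rewrite -(perm_uniq perm_is).
have sub' : {subset (i :: s) ++ map fst l <= U}.
  by move=> j; rewrite -(perm_mem perm_is); exact: sub.
have sub2 : {subset s ++ map fst l <= U}.
  by move=> j js; apply: sub'; rewrite inE js orbT.
have us2 : uniq (s ++ map fst l) by case/andP: us'.
have pos : prob P (E i `&` ((\bigcap_(k in [set` s]) E k) `&` literals l)) =
    prob P (E i) * prob P ((\bigcap_(k in [set` s]) E k) `&` literals l).
  by rewrite setIA -bigcap_cons !IH// big_cons mulrA.
rewrite literals_cons big_cons /= setICA mulrCA -IH//.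
case: b {us sub perm_is} => //.
rewrite setIC -setDE probD; first by rewrite [X in _ - prob P X]setIC pos mulrBl mul1r.
  apply: measurableI; first apply: measurable_bigcap_seq.
    by move=> k ks; apply: sub2; rewrite mem_cat ks.
  by apply: measurable_literals => k ks; apply: sub2; rewrite mem_cat ks orbT.
exact: mE.
Qed.

Lemma prob_literals l : uniq (map fst l) -> {subset map fst l <= U} ->
  prob P (literals l) =
  \prod_(y <- l) (if y.2 then prob P (E y.1) else 1 - prob P (E y.1)).
Proof.
move=> ul sub; have := @prob_bigcap_literals [::] l ul sub.
by rewrite classical_sets.set_nil bigcap_set0 setTI big_nil mul1r.
Qed.

(* Splitting on the events E i for i in s, one at a time, refines literals l until
   F either contains it or is disjoint from it. *)
Lemma indep_literals_depends (A : pred I) H s l F : measurable H ->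
  (forall l', uniq (map fst l') -> {subset map fst l' <= U} ->
     {in map fst l', forall i, A i} ->
     prob P (H `&` literals l') = prob P H * prob P (literals l')) ->
  uniq (s ++ map fst l) -> {subset s ++ map fst l <= U} ->
  {in s ++ map fst l, forall i, A i} ->
  depends (mem (s ++ map fst l)) F ->
  measurable (F `&` literals l) /\
  prob P (H `&` (F `&` literals l)) = prob P H * prob P (F `&` literals l).
Proof.
move=> mH indepH; elim: s l => [|i s IH] l us sub inA dF.
  have [Fl|/set0P[w [Fw lw]]] := eqVneq (F `&` literals l) set0.
    by rewrite Fl setI0 /prob measure0 /= mulr0; split.
  have -> : F `&` literals l = literals l; last first.
    by split; [exact: measurable_literals|exact: indepH].
  apply/seteqP; split=> [v []//|v lv]; split=> //.
  apply: dF Fw => j jU /= /mapP[y yl ->].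
  by rewrite lw// lv.
have iU : i \in U by apply: sub; rewrite inE eqxx.
have split_i : F `&` literals l =
    F `&` literals ((i, true) :: l) `|` F `&` literals ((i, false) :: l).
  by rewrite -setIUr !literals_cons -setIUl setUv setTI.
have perm_is b : perm_eq ((i :: s) ++ map fst l) (s ++ map fst ((i, b) :: l)).
  by rewrite perm_sym; exact/permPl/(perm_catCA s [:: i]).
have IHb b : measurable (F `&` literals ((i, b) :: l)) /\
    prob P (H `&` (F `&` literals ((i, b) :: l))) =
    prob P H * prob P (F `&` literals ((i, b) :: l)).
  apply: IH.
  - by rewrite -(perm_uniq (perm_is b)).
  - by move=> j; rewrite -(perm_mem (perm_is b)); exact: sub.
  - by move=> j; rewrite -(perm_mem (perm_is b)); exact: inA.
  - by apply: depends_sub dF => j _; rewrite !topredE (perm_mem (perm_is b)).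
have [m1 e1] := IHb true; have [m0 e0] := IHb false.
have disj : F `&` literals ((i, true) :: l) `&`
    (F `&` literals ((i, false) :: l)) = set0.
  by rewrite setIACA !literals_cons [X in _ `&` X]setIACA setICr set0I setI0.
rewrite split_i; split; first exact: measurableU.
rewrite setIUr !probU// ?e1 ?e0 ?mulrDr//.
- exact: measurableI.
- exact: measurableI.
- by rewrite setIACA disj setI0.
Qed.

(** The splitting starts with no literals and with [s] listing the sources in [A]. Keeping [H]
    arbitrary lets the result be applied to each of two events in turn. *)
Lemma indep_depends_literals (A : pred I) H F : measurable H ->
  (forall l', uniq (map fst l') -> {subset map fst l' <= U} ->
     {in map fst l', forall i, A i} ->
     prob P (H `&` literals l') = prob P H * prob P (literals l')) ->
  depends A F -> measurable F /\ prob P (H `&` F) = prob P H * prob P F.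
Proof.
move=> mH indepH dF; pose s := undup [seq i <- U | A i].
have := @indep_literals_depends A H s [::] F mH indepH.
rewrite literals_nil setIT /= cats0; apply.
- exact: undup_uniq.
- by move=> i; rewrite mem_undup mem_filter => /andP[].
- by move=> i; rewrite mem_undup mem_filter => /andP[].
- by apply: depends_sub dF => i iU Ai /=; rewrite mem_undup mem_filter Ai.
Qed.

(** With the whole space as [H] the independence condition is trivial, and measurability is what
    remains. *)
Lemma depends_measurable A F : depends A F -> measurable F.
Proof.
move=> /(@indep_depends_literals A setT) []// l ul sub _.
by rewrite setTI prob_setT mul1r.
Qed.

(** The passage from literals to events is made twice, first for [H] with [F] fixed, then for [F]
    with the literals of [H] fixed. This leaves two lists of literals, which have no source in
    common because [A] and [B] are disjoint on [U]. *)
Lemma prob_dependsI (A B : pred I) F H : {in U, forall s, A s -> B s -> False} ->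
  depends A F -> depends B H ->
  prob P (F `&` H) = prob P F * prob P H.
Proof.
move=> AB dF dH; have mF := depends_measurable dF.
apply: (indep_depends_literals mF _ dH).2 => l ul sub inB.
have ml := measurable_literals sub.
rewrite setIC mulrC; apply: (indep_depends_literals ml _ dF).2 => l' ul' sub' inA.
have -> : literals l `&` literals l' = literals (l ++ l').
  apply/seteqP; split=> w.
    by case=> h h' y; rewrite mem_cat => /orP[/h|/h'].
  by move=> h; split=> y yl; apply: h; rewrite mem_cat yl ?orbT.
rewrite !prob_literals ?big_cat// map_cat; last first.
  by move=> i; rewrite mem_cat => /orP[/sub|/sub'].
rewrite cat_uniq ul ul' andbT; apply/hasPn => i il'; apply/negP => il.
exact: (AB i (sub _ il) (inA _ il') (inB _ il)).
Qed.

Lemma prob_depends_all (K : eqType) (ks : seq K) (A : K -> pred I)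
    (F : K -> set T) : uniq ks ->
  {in U, forall s k k', A k s -> A k' s -> k = k'} ->
  (forall k, k \in ks -> depends (A k) (F k)) ->
  prob P [set w | forall k, k \in ks -> F k w] = \prod_(k <- ks) prob P (F k).
Proof.
move=> + disj; elim: ks => [_ _|k ks IH /= /andP[kks uks] dF].
  rewrite big_nil -[RHS](prob_setT P); congr prob.
  by apply/seteqP; split.
have dFs k' : k' \in ks -> depends (A k') (F k').
  by move=> k'ks; apply: dF; rewrite inE k'ks orbT.
rewrite big_cons -IH//.
(* The second group is the union of the groups of the tail; it determines the intersection of the
   remaining events. *)
rewrite -(@prob_dependsI (A k) [pred s | has (A^~ s) ks]).
- congr prob; apply/seteqP; split=> w.
    move=> h; split; first by apply: h; rewrite inE eqxx.
    by move=> k' k'ks; apply: h; rewrite inE k'ks orbT.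
  by case=> Fk h k'; rewrite inE => /orP[/eqP->|/h].
- move=> s sU Aks /hasP[k' k'ks Ak's].
  by move: kks; rewrite (disj _ sU _ _ Aks Ak's) k'ks.
- by apply: dF; rewrite inE eqxx.
- move=> w w' h Fw k' k'ks; apply: dFs (Fw _ k'ks) => // s sU Ak's.
  by apply: h => //; apply/hasP; exists k'.
Qed.

(** Prescribing the value of the random set prescribes, for each [k] in [S], either [F k] or its
    complement, and both are determined by the same group of sources. *)
Lemma prob_random_set (J : finType) (A : J -> pred I) (F : J -> set T)
    (S S' : {set J}) : S' \subset S ->
  {in U, forall s k k', A k s -> A k' s -> k = k'} ->
  {in S, forall k, depends (A k) (F k)} ->
  prob P [set w | [set k in S | w \in F k]%SET = S'] =
  (\prod_(k in S') prob P (F k)) * \prod_(k in S :\: S') (1 - prob P (F k)).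
Proof.
move=> S'S disj dF.
pose F' k := if k \in S' then F k else ~` F k.
have -> : [set w | [set k in S | w \in F k]%SET = S'] =
    [set w | forall k, k \in enum S -> F' k w].
  apply/seteqP; split=> w /=.
    move=> Sw k; rewrite mem_enum => kS; rewrite /F' -Sw inE kS /=.
    by case: ifPn; [move/set_mem|rewrite notin_setE].
  move=> h; apply/setP => k; rewrite inE.
  have [kS /=|kS] := boolP (k \in S); last first.
    by apply/esym/negbTE; apply: contra kS => /(fintype.subsetP S'S).
  have := h k; rewrite mem_enum kS /F' => /(_ isT).
  by case: ifPn => _ Fkw; [exact: mem_set|apply/negbTE; rewrite notin_setE].
rewrite (prob_depends_all (A := A) _ disj) ?enum_uniq//; last first.
  move=> k; rewrite mem_enum => kS; rewrite /F'; case: ifPn => _; first exact: dF.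
  move=> w w' h nFw Fw'; apply: nFw; apply: dF Fw' => // s sU As.
  by rewrite h.
rewrite big_enum /= (bigID (mem S')) /=; congr (_ * _).
  apply: eq_big => [k|k /andP[_ kS']]; last by rewrite /F' kS'.
  by rewrite andb_idl// => /(fintype.subsetP S'S).
apply: eq_big => [k|k /andP[kS kS']]; first by rewrite inE andbC.
by rewrite /F' (negbTE kS') probC//; exact: depends_measurable (dF _ kS).
Qed.

End Independence.

(** * Sums over sets by cardinality, and the finite list of sources *)

Lemma in_set_bool (T : Type) (b : T -> bool) w : (w \in [set v | b v]) = b w.
Proof. by apply/idP/idP => [/set_mem|/mem_set]. Qed.

(** After exchanging the sums, each [Y] contributes only at [k = #|Y|]. Double sums over a size and
    a set thereby become sums over the values of a random set. *)
Lemma sum_card_range (R : nmodType) (J : finType) (Q : pred {set J}) (a b : nat)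
    (g : {set J} -> R) :
  \sum_(a <= k < b) \sum_(Y : {set J} | Q Y && (#|Y| == k)) g Y =
  \sum_(Y : {set J} | Q Y && (a <= #|Y| < b)%N) g Y.
Proof.
under eq_bigr do rewrite big_mkcondr /=.
rewrite exchange_big /= [RHS]big_mkcondr /=; apply: eq_bigr => Y _.
rewrite -big_mkcond /=; under eq_bigl do rewrite eq_sym.
by rewrite big_nat1_eq.
Qed.

(** The type of sources is infinite because phases are natural numbers; the independence results
    above take a finite list. *)
Definition source_list (n : nat) (G : seq component) : seq (source n) :=
  [seq s <- [seq inl i | i <- enum 'I_n] ++
            [seq inr (j, p) | j <- iota 1 (size G),
                              p <- enum {: option 'I_n * option 'I_n}] |
     s \in sources n G].

Lemma mem_source_list n G : source_list n G =i sources n G.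
Proof.
move=> s; rewrite mem_filter andb_idr// => sG; rewrite mem_cat.
case: s sG => [i _|[j p] sG]; first by rewrite map_f ?mem_enum.
apply/orP; right; apply/allpairsP; exists (j, p); rewrite mem_enum; split=> //.
by case: p sG => u v /andP[jG _]; rewrite mem_iota add1n ltnS.
Qed.

(** Fault events belong to phase 0, whose active set they determine, so that phase [k] is determined
    by the sources of phase at most [k]. *)
Definition source_phase (n : nat) (s : source n) : nat :=
  if s is inr (j, _) then j else 0.

(* The backup whose activation the source can influence: the receiver of a
   transmission between backups or from the primary, the sender of one to the
   primary. *)
Definition source_backup (n : nat) (s : source n) : option 'I_n :=
  match s with
  | inl i => Some i
  | inr (_, (u, v)) => if v is Some _ then v else u
  end.

(** * The activation rule and its probability within one phase *)

Section Protocol.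
Variables (R : realType) (d : measure_display) (T : measurableType d).
Variables (P : probability T R) (n f : nat) (G : seq component).
Hypothesis G_wf : well_formed G.
Variables (P0 : 'I_n -> R) (PL : node n -> node n -> R).
Variables (nonfaulty : 'I_n -> set T) (delivered : nat -> node n -> node n -> set T).
Let E := source_event nonfaulty delivered.
Hypothesis events_measurable : forall s : source n, s \in sources n G ->
  measurable (E s).
Hypothesis nonfaulty_prob : forall i : 'I_n, prob P (nonfaulty i) = P0 i.
Hypothesis delivered_prob : forall (j : nat) (u v : node n),
  (1 <= j <= size G)%N -> link (graph (phase G j)) u v ->
  prob P (delivered j u v) = PL u v.
Hypothesis events_independent : mutually_independent P (sources n G) E.

Let U := source_list n G.
Let act := activated f nonfaulty delivered G.

Let mE : forall s, s \in U -> measurable (E s).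
Proof. by move=> s; rewrite mem_source_list; exact: events_measurable. Qed.

Let indepE : mutually_independent P (mem U) E.
Proof.
move=> s us sub; apply: events_independent => // x xs.
by rewrite -mem_source_list; exact: sub.
Qed.

Lemma activates_congr j S i w w' : (1 <= j <= size G)%N ->
  {in U, forall s, (source_phase s == j) && (source_backup s == Some i) ->
     (w \in E s) = (w' \in E s)} ->
  activates f delivered w (graph (phase G j)) j S i =
  activates f delivered w' (graph (phase G j)) j S i.
Proof.
move=> jG agree.
have del u v : link (graph (phase G j)) u v -> (if v is Some _ then v else u) = Some i ->
    (w \in delivered j u v) = (w' \in delivered j u v).
  move=> luv uvi; have := agree (inr (j, (u, v))); rewrite mem_source_list.
  (* Membership in [sources] is convertible to a conjunction of a phase range and a link; the
     pattern exposes it. *)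
  by rewrite /= uvi !eqxx; apply=> //; rewrite -[X in is_true X]/(_ && _) jG.
rewrite /activates; case: (graph _) del => del; [exact: del..|].
congr (_ <= _)%N; apply: eq_card => u; rewrite !inE.
have [|ui] := eqVneq u i; first by rewrite !andFb.
by rewrite (del (Some u) (Some i)).
Qed.

Lemma activates_depends j S i : (1 <= j <= size G)%N ->
  depends U E [pred s | (source_phase s == j) && (source_backup s == Some i)]
    [set w | activates f delivered w (graph (phase G j)) j S i].
Proof. by move=> jG w w' h /=; rewrite (@activates_congr _ _ _ _ w'). Qed.

Lemma prob_activates j (S : {set 'I_n}) i : (1 <= j <= size G)%N -> i \in S ->
  prob P [set w | activates f delivered w (graph (phase G j)) j S i] =
  activation_prob f PL (graph (phase G j)) S i.
Proof.
move=> jG iS; have del u v := @delivered_prob j u v jG.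
have mdel u v : link (graph (phase G j)) u v -> inr (j, (u, v)) \in U.
  by move=> luv; rewrite mem_source_list -[X in is_true X]/(_ && _) jG.
rewrite /activates /activation_prob; case: (graph _) del mdel => del mdel.
- by rewrite -del//; congr prob; apply/seteqP; split=> w /= => [/set_mem|/mem_set].
- by rewrite -del//; congr prob; apply/seteqP; split=> w /= => [/set_mem|/mem_set].
(* In the many-to-many case, [X w] is the set of senders heard by [i]. Its members occur
   independently, each governed by one transmission, and the sum in the formula runs over its
   possible values. *)
pose X w := [set u in S :\ i | w \in delivered j (backup u) (backup i)]%SET.
pose A u : pred (source n) := pred1 (inr (j, (backup u, backup i))).
have disj : {in U, forall s u u', A u s -> A u' s -> u = u'}.
  by move=> s _ u u' /eqP -> /eqP [].
have dA : {in S :\ i, forall u,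
    depends U E (A u) (delivered j (backup u) (backup i))}.
  move=> u; rewrite !inE => /andP[ui _] w w' h /mem_set dw; apply: set_mem.
  rewrite -[X in is_true X]/(w' \in E (inr (j, (backup u, backup i)))) -h//; last exact: eqxx.
  exact: mdel.
have pX (Y : {set 'I_n}) : Y \subset S :\ i -> prob P [set w | X w = Y] =
    (\prod_(u in Y) PL (backup u) (backup i)) *
    \prod_(v in S :\: (i |: Y)) (1 - PL (backup v) (backup i)).
  move=> YS; rewrite (prob_random_set mE indepE YS disj dA) -finset.setDDl.
  congr (_ * _); apply: eq_bigr => u.
    by move=> /(fintype.subsetP YS); rewrite !inE => /andP[ui _]; rewrite del.
  by rewrite !inE => /andP[_ /andP[ui _]]; rewrite del.
have X0 (Y : {set 'I_n}) : ~~ (Y \subset S :\ i) -> [set w | X w = Y] = set0.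
  move=> /negP YS; apply/seteqP; split=> // w /= XY; case: YS; rewrite -XY.
  by apply/fintype.subsetP => u; rewrite inE => /andP[].
rewrite -[X in prob P X]setTI (@prob_partition _ _ _ P _
  [pred Y : {set 'I_n} | n - f - 1 <= #|Y|]%N X); last first.
  move=> Y; rewrite setTI; have [YS|/X0->] := boolP (Y \subset S :\ i) => //.
  apply: (depends_measurable P mE (A := predT)) => w w' h <-.
  apply/setP => u; rewrite !inE; have [|ui] := eqVneq u i; first by rewrite !andFb.
  by rewrite [in RHS](h (inr (j, (backup u, backup i))) _ isT)//; exact: mdel.
rewrite sum_card_range (bigID (fun Y : {set 'I_n} => Y \subset S :\ i)) /=.
rewrite [X in _ + X]big1 ?addr0; last first.
  by move=> Y /andP[_ /X0 ->]; rewrite setI0 /prob measure0.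
apply: eq_big => [Y|Y /andP[_ YS]]; last by rewrite setTI pX.
rewrite andbC; apply: andb_id2l => YS; rewrite andb_idr// => _.
(* As [i] is in [S], a subset of [S :\ i] has fewer than [#|S|] elements, so the upper summation
   limit holds automatically. *)
by rewrite (cardsD1 i S) iS add1n ltnS subset_leq_card.
Qed.

(** * One-step transitions and their independence from earlier phases *)

(** The preceding set is frozen at [S]: [step j S] is then determined by sources of phase [j] alone,
    whereas [act j] also involves earlier ones. *)
Definition step (j : nat) (S : {set 'I_n}) (w : T) : {set 'I_n} :=
  [set i in S | activates f delivered w (graph (phase G j)) j S i]%SET.

Lemma actS j w : (1 <= j <= size G)%N ->
  act j w = step j (act (j - dep (phase G j))%N w) w.
Proof. exact: activatedS. Qed.

Lemma step_depends j S S' : (1 <= j <= size G)%N ->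
  depends U E [pred s | source_phase s == j] [set w | step j S w = S'].
Proof.
move=> jG w w' h <-; apply/setP => i; rewrite !inE.
rewrite [in RHS](@activates_congr _ _ _ _ w')// => s sU /andP[sj _].
exact: h.
Qed.

Lemma prob_step j (S S' : {set 'I_n}) : (1 <= j <= size G)%N -> S' \subset S ->
  prob P [set w | step j S w = S'] =
  transition_prob f PL (graph (phase G j)) S S'.
Proof.
move=> jG S'S.
pose F i := [set w | activates f delivered w (graph (phase G j)) j S i].
have -> : [set w | step j S w = S'] =
    [set w | [set i in S | w \in F i]%SET = S'].
  apply/seteqP; split=> w /= <-; apply/setP => i.
    by rewrite !inE in_set_bool.
  by rewrite !inE in_set_bool.
rewrite (prob_random_set mE indepE S'S _ (fun i _ => @activates_depends j S i jG)).
  congr (_ * _); apply: eq_bigr => i.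
    by move=> /(fintype.subsetP S'S) iS; rewrite prob_activates.
  by rewrite inE => /andP[_ iS]; rewrite prob_activates.
by move=> s _ i i' /andP[_ /eqP si] /andP[_ /eqP]; rewrite si => -[].
Qed.

Lemma dep_lt j : (1 <= j <= size G)%N -> (j - dep (phase G j) < j)%N.
Proof.
move=> jG; have [/andP[r1 rj] _] := G_wf jG.
by rewrite ltn_subrL r1; case/andP: jG.
Qed.

(** Strong induction is used because a phase may refer back to any earlier phase. *)
Lemma act_congr k w w' : (k <= size G)%N ->
  {in U, forall s, (source_phase s <= k)%N -> (w \in E s) = (w' \in E s)} ->
  act k w = act k w'.
Proof.
elim/ltn_ind: k => -[_ _|k IH kG] h.
  rewrite /act !activated0; apply/setP => i; rewrite !inE.
  by apply: (h (inl i)); rewrite ?mem_source_list.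
have kG' : (1 <= k.+1 <= size G)%N by [].
have rk := dep_lt kG'.
rewrite (actS w kG') (actS w' kG') (IH _ rk); last first.
- by move=> s sU sk; apply: h => //; exact: leq_trans sk (ltnW rk).
- exact: leq_trans (ltnW rk) kG.
apply/setP => i; rewrite !inE (@activates_congr _ _ _ _ w')// => s sU.
by move=> /andP[/eqP sk _]; apply: h => //; rewrite sk.
Qed.

Lemma act_depends k S : (k <= size G)%N ->
  depends U E [pred s | (source_phase s <= k)%N] [set w | act k w = S].
Proof. by move=> kG w w' h <-; apply/esym/act_congr. Qed.

(** An event determined by the active sets of all phases is determined by the finitely many sources;
    this settles the measurability conditions below. *)
Lemma measurable_act (A : set T) :
  (forall w w', (forall k, (k <= size G)%N -> act k w = act k w') ->
     A w -> A w') ->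
  measurable A.
Proof.
move=> hA; apply: (depends_measurable P mE (A := predT)).
by move=> w w' h; apply: hA => k kG; apply: act_congr => // s sU _; exact: h.
Qed.

Lemma measurable_act_eq k S : (k <= size G)%N ->
  measurable [set w | act k w = S].
Proof. by move=> kG; apply: measurable_act => w w' h /= <-; rewrite h. Qed.

Lemma prob_act0 S0 : prob P [set w | act 0%N w = S0] = initial_prob P0 S0.
Proof.
have -> : [set w | act 0%N w = S0] =
    [set w | [set i in finset.setT | w \in nonfaulty i]%SET = S0].
  by apply/seteqP; split=> w /= <-; rewrite /act activated0; apply/setP => i;
    rewrite !inE.
rewrite (prob_random_set mE indepE (A := fun i => pred1 (inl i)) (finset.subsetT _)).
- rewrite /initial_prob finset.setTD; congr (_ * _); apply: eq_bigr => i _;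
    by rewrite nonfaulty_prob.
- by move=> s _ i i' /eqP -> /eqP [].
- move=> i _ w w' h /mem_set Fw; apply: set_mem.
  by rewrite -[X in is_true X]/(w' \in E (inl i)) -h ?mem_source_list//; exact: eqxx.
Qed.

(** On the conditioning event, [act j] agrees with [step j S]; the latter uses sources of phase [j],
    the conditioning event only earlier ones. The product form also covers null conditioning
    events. *)
Lemma prob_transition j (S S' : {set 'I_n}) : (1 <= j <= size G)%N -> S' \subset S ->
  prob P ([set w | act j w = S'] `&`
          [set w | act (j - dep (phase G j))%N w = S]) =
  transition_prob f PL (graph (phase G j)) S S' *
  prob P [set w | act (j - dep (phase G j))%N w = S].
Proof.
move=> jG S'S; have rj := dep_lt jG.
rewrite -prob_step// -(prob_dependsI mE indepE _ (@step_depends j S S' jG)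
  (act_depends (S := S) _)).
- congr prob; apply/seteqP; split=> w /= [].
    by move=> <- <-; rewrite -actS.
  by move=> <- <-; rewrite actS.
- by move=> s _ /eqP /= ->; rewrite leqNgt rj.
- by apply: leq_trans (ltnW rj) _; case/andP: jG.
Qed.

Lemma prob_activation j (S : {set 'I_n}) i : (1 <= j <= size G)%N -> i \in S ->
  prob P ([set w | i \in act j w] `&`
          [set w | act (j - dep (phase G j))%N w = S]) =
  activation_prob f PL (graph (phase G j)) S i *
  prob P [set w | act (j - dep (phase G j))%N w = S].
Proof.
move=> jG iS; have rj := dep_lt jG.
rewrite -prob_activates// -(prob_dependsI mE indepE _ (@activates_depends j S i jG)
  (act_depends (S := S) _)).
- congr prob; apply/seteqP; split=> w /= [+ Sw]; rewrite actS// Sw inE iS//.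
- by move=> s _ /andP[/eqP + _] /= => ->; rewrite leqNgt rj.
- by apply: leq_trans (ltnW rj) _; case/andP: jG.
Qed.

(** * Probability of an activation history *)

Definition history_event (S : seq {set 'I_n}) : set T :=
  [set w | forall j, (j <= size G)%N -> act j w = nth finset.set0 S j].

Lemma prob_history (S : seq {set 'I_n}) :
  let S_ := nth finset.set0 S in
  (forall j, (1 <= j <= size G)%N -> S_ j \subset S_ (j - dep (phase G j))%N) ->
  prob P (history_event S) = initial_prob P0 (S_ 0%N) *
    \prod_(1 <= j < (size G).+1)
      transition_prob f PL (graph (phase G j)) (S_ (j - dep (phase G j))%N) (S_ j).
Proof.
move=> S_ chain.
(* Freezing each preceding set at its prescribed value makes [F j] depend on sources of phase [j]
   only. The intersection is unchanged: by strong induction, the actual sets are the prescribed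
   ones. *)
pose F j := if j is 0 then [set w | act 0%N w = S_ 0%N]
            else [set w | step j (S_ (j - dep (phase G j))%N) w = S_ j].
have -> : history_event S =
    [set w | forall j, j \in index_iota 0 (size G).+1 -> F j w].
  apply/seteqP; split=> w /= h.
    move=> j; rewrite mem_index_iota ltnS => /= jG.
    case: j jG => [_|j jG]; first exact: h.
    have hS k : (k <= size G)%N -> S_ k = act k w by move=> kG; rewrite /S_ h.
    rewrite /F /= !hS//; first exact/esym/actS.
    exact: leq_trans (ltnW (@dep_lt j.+1 jG)) jG.
  elim/ltn_ind => -[_ _|j IH jG].
    by apply: (h 0%N); rewrite mem_index_iota.
  have := h j.+1; rewrite mem_index_iota ltnS => /(_ jG).
  rewrite actS// IH//; first exact: dep_lt.
  exact: leq_trans (ltnW (@dep_lt j.+1 jG)) jG.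
rewrite (prob_depends_all mE indepE
  (A := fun j => [pred s | source_phase s == j]) (iota_uniq _ _)).
- rewrite [LHS](big_ltn (m := 0) (n := (size G).+1))// [prob P (F 0%N)]prob_act0.
  congr (_ * _).
  apply: eq_big_nat => -[//|j]; rewrite ltnS => jG.
  by rewrite /F prob_step//; exact: chain.
- by move=> s _ j j' /eqP <- /eqP <-.
- move=> [|j]; rewrite mem_iota add0n subn0 ltnS => /= jG.
    have := act_depends (S := S_ 0%N) (leq0n (size G)).
    by apply: depends_sub => s _ /=; rewrite leqn0.
  exact: step_depends.
Qed.

Lemma history_event_sub S j : (j <= size G)%N ->
  history_event S `<=` [set w | act j w = nth finset.set0 S j].
Proof. by move=> jG w; apply. Qed.

Lemma measurable_history S : measurable (history_event S).
Proof.
apply: measurable_act => w w' h Aw j jG; rewrite -h//; exact: Aw.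
Qed.

Lemma prob_history_cond (S : seq {set 'I_n}) :
  let S_ := nth finset.set0 S in
  (forall j, (1 <= j <= size G)%N -> S_ j \subset S_ (j - dep (phase G j))%N) ->
  prob P (history_event S) = prob P [set w | act 0%N w = S_ 0%N] *
    \prod_(1 <= j < (size G).+1)
      cond_prob P [set w | act j w = S_ j]
        [set w | act (j - dep (phase G j))%N w = S_ (j - dep (phase G j))%N].
Proof.
move=> S_ chain.
pose pre j := [set w | act (j - dep (phase G j))%N w = S_ (j - dep (phase G j))%N].
have preG j : (1 <= j <= size G)%N -> (j - dep (phase G j) <= size G)%N.
  by move=> jG; apply: leq_trans (ltnW (dep_lt jG)) _; case/andP: jG.
(* If no conditioning event is null, each factor is a transition probability by division. *)
have [/allP pre_neq0|] :=
    boolP (all (fun j => prob P (pre j) != 0) (index_iota 1 (size G).+1)).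
  rewrite prob_history// prob_act0; congr (_ * _); apply: eq_big_nat => j.
  rewrite ltnS => jG; rewrite /cond_prob prob_transition//; last exact: chain.
  by rewrite mulfK//; apply: pre_neq0; rewrite mem_index_iota.
(* Otherwise the history lies in a null event, and the matching factor on the right is 0 because
   division by 0 gives 0. *)
case/allPn => j; rewrite mem_index_iota ltnS => jG; rewrite negbK => /eqP pre0.
rewrite (prob_eq0 (measurable_history S) (measurable_act_eq _ (preG _ jG))
  (history_event_sub (preG _ jG)) pre0).
apply/esym/eqP; rewrite mulf_eq0 prodf_seq_eq0; apply/orP; right.
apply/hasP; exists j; first by rewrite mem_index_iota.
by rewrite /cond_prob pre0 invr0 mulr0 eqxx.
Qed.

(** * Summation over chains of active sets *)

(** The induction is on the components [G2] still to be summed over; [h] fixes the sets of phase 0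
    and of the phases of [G1], whence its extra entry. Each sum splits an event by the active set of
    phase [size h]. *)
Lemma phase_sums_prob G1 G2 h : G = G1 ++ G2 -> size h = (size G1).+1 ->
  phase_sums G2 h (fun S => prob P (history_event S)) =
  prob P [set w | (forall j, (j < size h)%N -> act j w = nth finset.set0 h j) /\
    forall j, (size h <= j <= size G)%N ->
      (min_active (phase G j) <= #|act j w|)%N].
Proof.
elim: G2 G1 h => [|c G2 IH] G1 h eG sh /=.
  congr prob; have shG : size h = (size G).+1 by rewrite eG cats0.
  apply/seteqP; split=> w hw.
    split=> [j|j]; first by rewrite shG ltnS; exact: hw.
    by rewrite shG => /andP[/leq_trans h1 /h1]; rewrite ltnn.
  by case: hw => hw _ j jG; apply: hw; rewrite shG.
(* Phases of components count from 1 and list positions from 0, so the head of [G2] is the component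
   of phase [size h]. *)
have ec : c = phase G (size h).
  by rewrite sh /phase eG nth_cat ltnn subnn.
have hG : (1 <= size h <= size G)%N.
  by rewrite eG sh size_cat /= addnS ltnS leq_addr.
set S := nth _ _ _.
pose A := [set w | (forall j, (j < size h)%N -> act j w = nth finset.set0 h j) /\
    forall j, ((size h).+1 <= j <= size G)%N ->
      (min_active (phase G j) <= #|act j w|)%N].
have rh := dep_lt hG.
have AS w : A w -> act (size h) w \subset S.
  move=> [hw _]; rewrite actS// hw// -ec -/S.
  by apply/fintype.subsetP => i; rewrite inE => /andP[].
rewrite sum_card_range.
rewrite [X in prob P X](_ : _ =
    A `&` [set w | (min_active c <= #|act (size h) w|)%N]); last first.
  apply/seteqP; split=> w.
    move=> [hw mw]; split; last by rewrite /= ec; apply: mw; case/andP: hG => _ ->; rewrite leqnn.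
    by split=> // j /andP[hj jG]; apply: mw; rewrite jG ltnW.
  move=> [[hw mw] mh]; split=> // j; rewrite leq_eqVlt => /andP[/orP[/eqP<- _|hj jG]].
    by rewrite -ec.
  by apply: mw; rewrite hj.
rewrite (@prob_partition _ _ _ P _ (fun S' : {set 'I_n} => min_active c <= #|S'|)%N
  (act (size h))); last first.
  move=> S'; apply: measurable_act => w w' e [[hw mw] <-]; split.
    split=> j jh; rewrite -e.
    - exact: hw.
    - exact: leq_trans (ltnW jh) (andP hG).2.
    - exact: mw.
    - by case/andP: jh.
  by rewrite /= e//; case/andP: hG.
(* Values not contained in [S] have empty slices, since nodes active in this phase were active in
   the one it depends on. *)
rewrite [RHS](bigID (fun S' : {set 'I_n} => S' \subset S)) /= [X in _ + X]big1 ?addr0; last first.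
  move=> S' /andP[_ S'S].
  rewrite [X in prob P X](_ : _ = set0) ?/prob ?measure0//.
  apply/seteqP; split=> // w [/AS + /= eS']; rewrite eS' => S'S'.
  by rewrite S'S' in S'S.
apply: eq_big => [S'|S' /andP[S'S _]].
  by rewrite [RHS]andbC; apply: andb_id2l => /subset_leq_card; rewrite -ltnS => ->; rewrite andbT.
rewrite (IH (rcons G1 c)); last 2 first.
- by rewrite cat_rcons.
- by rewrite !size_rcons sh.
rewrite size_rcons; congr prob; apply/seteqP; split=> w.
  move=> [hw mw]; split; last first.
    by have := hw (size h); rewrite nth_rcons ltnn eqxx; exact.
  split=> // j jh; rewrite hw ?ltnS 1?ltnW//.
  by rewrite nth_rcons jh.
move=> [[hw mw] /= S'w]; split=> // j; rewrite ltnS nth_rcons leq_eqVlt.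
by case: ltnP => [jh _|_ /orP[/eqP ->|//]]; [exact: hw|rewrite eqxx].
Qed.

(** Splitting by the active set of phase 0 reduces this to [phase_sums_prob] with an empty [G1]; the
    limit [n] on the size holds for every set of backups. *)
Lemma reliability :
  prob P [set w | (n - f <= #|act 0%N w|)%N /\
    forall j : nat, (1 <= j <= size G)%N ->
      (min_active (phase G j) <= #|act j w|)%N] =
  reliability_sum f G (fun S => prob P (history_event S)).
Proof.
rewrite /reliability_sum.
have -> := @sum_card_range _ _ predT (n - f) n.+1
  (fun S0 => phase_sums G [:: S0] (fun S => prob P (history_event S))).
pose A := [set w | forall j : nat, (1 <= j <= size G)%N ->
      (min_active (phase G j) <= #|act j w|)%N].
rewrite [X in prob P X](_ : _ = A `&` [set w | n - f <= #|act 0%N w|]%N); last first.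
  by apply/seteqP; split=> w [].
rewrite (@prob_partition _ _ _ P _ (fun S' : {set 'I_n} => n - f <= #|S'|)%N
  (act 0%N)); last first.
  move=> S'; apply: measurable_act => w w' e [mw <-]; split; last by rewrite /= e.
  by move=> j jG; rewrite -e; [exact: mw|case/andP: jG].
apply: eq_big => [S0|S0 _].
  by have := max_card (mem S0); rewrite card_ord /= ltnS => ->; rewrite andbT.
rewrite (@phase_sums_prob [::])//; congr prob; apply/seteqP; split=> w.
  by move=> [mw Sw]; split=> // -[].
by move=> [hw mw]; split=> //; exact: (hw 0%N).
Qed.

End Protocol.

Theorem theorem1 (R : realType) (d : measure_display) (T : measurableType d)
    (P : probability T R) (n f : nat) (f_lt_n : (f < n)%N)
    (G : seq component) (G_wf : well_formed G)
    (P0 : 'I_n -> R) (PL : node n -> node n -> R)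
    (nonfaulty : 'I_n -> set T) (delivered : nat -> node n -> node n -> set T)
    (events_measurable : forall s : source n, s \in sources n G ->
       measurable (source_event nonfaulty delivered s))
    (nonfaulty_prob : forall i : 'I_n, prob P (nonfaulty i) = P0 i)
    (delivered_prob : forall (j : nat) (u v : node n), (1 <= j <= size G)%N ->
       link (graph (phase G j)) u v -> prob P (delivered j u v) = PL u v)
    (events_independent :
       mutually_independent P (sources n G) (source_event nonfaulty delivered)) :
  let act := activated f nonfaulty delivered G in
  let joint (S : seq {set 'I_n}) :=
    prob P [set w | forall j : nat, (j <= size G)%N ->
                      act j w = nth finset.set0 S j] in
  let PC :=
    prob P [set w | (n - f <= #|act 0%N w|)%N /\
                    forall j : nat, (1 <= j <= size G)%N ->
                      (min_active (phase G j) <= #|act j w|)%N] in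
  [/\ PC = reliability_sum f G joint,
      forall S : seq {set 'I_n}, size S = (size G).+1 ->
        let S_ := nth finset.set0 S in
        (forall j : nat, (1 <= j <= size G)%N ->
           S_ j \subset S_ (j - dep (phase G j))%N) ->
        joint S = prob P [set w | act 0%N w = S_ 0%N] *
          \prod_(1 <= j < (size G).+1)
            cond_prob P [set w | act j w = S_ j]
              [set w | act (j - dep (phase G j))%N w =
                       S_ (j - dep (phase G j))%N]
        /\
        joint S = initial_prob P0 (S_ 0%N) *
          \prod_(1 <= j < (size G).+1)
            transition_prob f PL (graph (phase G j))
              (S_ (j - dep (phase G j))%N) (S_ j),
      forall S0 : {set 'I_n},
        prob P [set w | act 0%N w = S0] = initial_prob P0 S0
    & forall (j : nat) (S : {set 'I_n}), (1 <= j <= size G)%N ->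
        let pre := [set w | act (j - dep (phase G j))%N w = S] in
        prob P pre != 0 ->
        (forall i : 'I_n, i \in S ->
           cond_prob P [set w | i \in act j w] pre =
           activation_prob f PL (graph (phase G j)) S i) /\
        (forall S' : {set 'I_n}, S' \subset S ->
           cond_prob P [set w | act j w = S'] pre =
           transition_prob f PL (graph (phase G j)) S S')].
Proof.
move=> act joint PC; split.
- exact: (reliability P f G_wf events_measurable).
- move=> S _ S_ chain; split.
    exact: (prob_history_cond f G_wf events_measurable nonfaulty_prob
              delivered_prob events_independent chain).
  exact: (prob_history f G_wf events_measurable nonfaulty_prob
            delivered_prob events_independent chain).
- exact: (prob_act0 f events_measurable nonfaulty_prob events_independent).
- move=> j S jG pre pre0; split=> [i iS|S' S'S]; rewrite /cond_prob.
    by rewrite (prob_activation f G_wf events_measurable delivered_prob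
                  events_independent jG iS) mulfK.
  by rewrite (prob_transition f G_wf events_measurable delivered_prob
                events_independent jG S'S) mulfK.
Qed.
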